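(* The multiplicative order function $\mathrm{ord}(m,n)$ (for coprime integer arguments $n\ge3$ and $m\in\{2,\dots,n-1\}$) can be represented by the arithmetic term $$\frac{\varphi(n)}{\mathrm{HW}(M(m,n))/(2m^{\varphi(n)+1}+2)-(m^{\varphi(n)}+1)^4},$$ i.e. $\mathrm{ord}(m,n)$ equals this expression for all such $m,n$, where $$\begin{aligned}M(m,n)={}&\mathcal C(\varphi(n)^2+2,4)+\mathcal A(2nx_2,4)+\mathcal A(2x_1^2,4)+\mathcal A(-2(\varphi(n)+1)x_1,4)\\&+\mathcal A(-2nm^{x_1}x_2,4)+\mathcal A(2x_3,4)+\mathcal A(n^2x_2^2,4)+\mathcal A(-2\varphi(n)x_4,4)\\&+\mathcal A(-2m^{x_1},4)+\mathcal A(-2x_1x_3,4)+\mathcal A(x_3^2,4)\\&+\mathcal A(m^{2x_1},4)+\mathcal A(2x_1x_4,4)+\mathcal A(x_4^2,4),\end{aligned}$$ with $\mathcal C$ and $\mathcal A$ formed with the parameters $t=m^{\varphi(n)}+1$ and $w=2m^{\varphi(n)+1}+2$.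
   Context: For coprime integers $n\ge2$ and $m\in\{1,\dots,n-1\}$, $\mathrm{ord}(m,n)$ is the least positive integer $r$ with $m^r\equiv1\pmod n$. $\varphi$ is Euler's totient function, which itself is representable by an arithmetic term for $n\ge2$. $\mathrm{HW}(N)$ is the Hamming weight of $N$ (number of ones in its binary representation). $G_r(q,s)=\sum_{j=0}^{s}j^rq^j$ with $0^0=1$; for each fixed $r$ this has a closed form. Given parameters $t>1$, $w$ (depending on the arguments) and $k\ge1$: $$\mathcal C(\varepsilon,k)=(2^w-\varepsilon+1)\,\frac{2^{2wt^k}-1}{2^w+1},$$ and for a monomial $\mu=\alpha\, b_1^{\beta_1x_1}\cdots b_k^{\beta_kx_k}x_1^{\gamma_1}\cdots x_k^{\gamma_k}$ in the formal variables $x_1,\dots,x_k$ (with $\alpha$ an integer possibly negative, and absent exponential factors meaning $\beta_i=0$, absent powers meaning $\gamma_i=0$), $$\mathcal A(\mu,k)=-(2^w-1)\,\alpha\prod_{i=1}^kG_{\gamma_i}\!\left(2^{2wt^{i-1}}b_i^{\beta_i},\,t-1\right).$$ An arithmetic term is an expression built from natural-number constants and the variables by the operations $x+y$, $\max(x-y,0)$, $\lfloor x/y\rfloor$, $x^y$ (with $0^0=1$, $\lfloor x/0\rfloor=0$). Products, $\mathrm{HW}$ and $G_r$ (fixed $r$) are expressible by arithmetic terms and are used as abbreviations; formulas are written with ordinary subtraction and exact division for readability. *)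

(* Defs.v *)
From mathcomp Require Import all_boot all_order all_algebra cyclic.

Set Implicit Arguments.
Unset Strict Implicit.
Unset Printing Implicit Defensive.

Import Order.TTheory GRing.Theory Num.Theory.

Local Open Scope nat_scope.

(* [n - m] is truncated, [x %/ 0 = 0] and [0 ^ 0 = 1] in ssrnat/div, which are
   exactly the conventions for arithmetic terms. *)
Inductive aterm (k : nat) : Type :=
| ACst of nat
| AVar of 'I_k
| AAdd of aterm k & aterm k
| ASub of aterm k & aterm k
| ADiv of aterm k & aterm k
| APow of aterm k & aterm k.

Fixpoint aeval (k : nat) (v : 'I_k -> nat) (e : aterm k) : nat :=
  match e with
  | ACst c => c
  | AVar i => v i
  | AAdd a b => aeval v a + aeval v b
  | ASub a b => aeval v a - aeval v b
  | ADiv a b => aeval v a %/ aeval v b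
  | APow a b => aeval v a ^ aeval v b
  end.

(* The guard [coprime m n ==> _] only serves to make the minimum total: for
   [m] and [n] not coprime the value is the junk value 1. *)
Fact mult_ord_ex (m n : nat) :
  exists r, (0 < r) && (coprime m n ==> (m ^ r == 1 %[mod n])).
Proof.
case: (posnP n) => [-> | n_gt0].
  exists 1; rewrite expn1 /=; apply/implyP.
  by rewrite /coprime gcdn0 => /eqP->.
exists (totient n); rewrite totient_gt0 n_gt0 /=.
by apply/implyP => co_mn; apply/eqP/Euler_exp_totient.
Qed.

Definition mult_ord (m n : nat) : nat := ex_minn (mult_ord_ex m n).

(* The binary digits of [N] of index at least [N] vanish, since [N < 2 ^ N]. *)
Definition hamming (N : nat) : nat := \sum_(i < N) (N %/ 2 ^ i) %% 2.

Definition Gsum (r q s : nat) : nat := \sum_(j < s.+1) j ^ r * q ^ j.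

(* [Mono a b beta gamma] encodes
     a * prod_i b_i ^ (beta_i * x_i) * prod_i x_i ^ gamma_i.
   The variable [x_i] (numbered from 1) has index [i - 1] in the sequences;
   missing entries are read as 0, i.e., as absent factors. *)
Record mono : Type := Mono {
  mcoef : int;
  mbase : seq nat;
  mbexp : seq nat;
  mpexp : seq nat
}.

Local Open Scope ring_scope.

(* Rational values, so that subtraction is not truncated and division is not
   rounded. *)
Definition Cterm (t w : nat) (eps : int) (k : nat) : rat :=
  (2 ^+ w - eps%:~R + 1) * ((2 ^+ (2 * w * t ^ k)%N - 1) / (2 ^+ w + 1)).

(* The product is indexed from 0, whence [t ^ i] for the [t ^ (i - 1)] of the
   variables numbered from 1. *)
Definition Aterm (t w : nat) (mu : mono) (k : nat) : rat :=
  - (2 ^+ w - 1) * (mcoef mu)%:~R *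
  \prod_(i < k)
    (Gsum (nth 0 (mpexp mu) i)
          (2 ^ (2 * w * t ^ i) * nth 0 (mbase mu) i ^ nth 0 (mbexp mu) i)
          (t - 1))%N%:R.

Definition ord_t (m n : nat) : nat := (m ^ totient n + 1)%N.

Definition ord_w (m n : nat) : nat := (2 * m ^ (totient n + 1) + 2)%N.

Definition ord_M (m n : nat) : rat :=
  let phi : int := (totient n)%:Z in
  let C eps := Cterm (ord_t m n) (ord_w m n) eps 4 in
  let A a b beta gamma :=
    Aterm (ord_t m n) (ord_w m n) (Mono a b beta gamma) 4 in
    C (phi ^+ 2 + 2)
  + A (2 * n%:Z) [::] [::] [:: 0; 1]%N
  + A 2 [::] [::] [:: 2]%N
  + A (- (2 * (phi + 1))) [::] [::] [:: 1]%N
  + A (- (2 * n%:Z)) [:: m] [:: 1]%N [:: 0; 1]%N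
  + A 2 [::] [::] [:: 0; 0; 1]%N
  + A (n%:Z ^+ 2) [::] [::] [:: 0; 2]%N
  + A (- (2 * phi)) [::] [::] [:: 0; 0; 0; 1]%N
  + A (- 2) [:: m] [:: 1]%N [::]
  + A (- 2) [::] [::] [:: 1; 0; 1]%N
  + A 1 [::] [::] [:: 0; 0; 2]%N
  + A 1 [:: m] [:: 2]%N [::]
  + A 2 [::] [::] [:: 1; 0; 0; 1]%N
  + A 1 [::] [::] [:: 0; 0; 0; 2]%N.

(* [Num.truncn] only turns the rational number [ord_M m n] into the natural
   number it is equal to, whenever [ord_M m n \is a Num.nat]. *)
Definition ord_expr (m n : nat) : rat :=
  (totient n)%:R /
  ((hamming (Num.truncn (ord_M m n)))%:R
     / (2 * m%:R ^+ (totient n + 1) + 2)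
   - (m%:R ^+ totient n + 1) ^+ 4).

(* Main.v *)
Require Import Defs.
From mathcomp Require Import all_boot all_order all_algebra cyclic.
From mathcomp Require Import zify ring lra.

Set Implicit Arguments.
Unset Strict Implicit.
Unset Printing Implicit Defensive.

Import Order.TTheory GRing.Theory Num.Theory.

(** Put P = phi(n), T = m^P and t = T + 1.  The coefficients of M(m, n) are those of the
    expansion of the sum of squares
      f(x1, x2, x3, x4) = (m^x1 - 1 - n x2)^2 + (P - x1 - x4)^2 + (x1 - 1 - x3)^2.
    At a zero of f in the cube [0, T]^4 the variable x1 lies between 1 and P, because x3 and
    x4 are natural numbers, and m^x1 is 1 modulo n; conversely such an x1 determines the
    other three variables, which do not exceed T.  As m^x1 = 1 modulo n means that ord(m, n)
    divides x1, the zeros are P / ord(m, n) in number ([card_ord_poly]).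

    The number M(m, n) stores f in base 2^(2w).  The product of the sums G, once expanded,
    is a sum over the points of the cube in which the point x is weighted by
    2^(2w (x1 + x2 t + x3 t^2 + x4 t^3)), so that the digit of M(m, n) at the place of x is
    (2^w - 1) (2^w + 1 - f(x)).  For f(x) = 0 this is 2^(2w) - 1, whose binary digits are
    2w ones.  For 1 <= f(x) <= 2^w its upper half is a w-bit number and its lower half is
    the bitwise complement of the upper one, so that it has exactly w ones.  The role of w
    is that f is at most 2^w on the whole cube ([ord_poly_le]).  Hence
    HW(M(m, n)) = w (t^4 + P / ord(m, n)) ([ord_cube], from the general [cube_count]), and
    solving for ord(m, n) gives the formula, an exact one since ord(m, n) divides phi(n).

    To see that the order is the value of an arithmetic term, take P = n^2 instead of phi(n):
    the number of zeros becomes the rounded quotient of n^2 by ord(m, n), and rounding is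
    harmless because ord(m, n) <= n ([divn_divn_small]).  It remains to write the encoded
    number and its Hamming weight with the term operations.  The sums G have closed forms
    by a recursion on the exponent ([Gsum_rec]).  The Hamming weight of N is the exponent of
    2 in the binomial coefficient of 2N over N ([hamming_logn]).  A binomial coefficient is
    a digit of a power of B + 1 in a large base B ([bin_digit]), and a gcd is a digit of a
    product of two geometric sums ([gcdn_digit]).  Finally the exponent v of 2 in X is read
    off the gcd of X and 2^X, which is 2^v, as a discrete logarithm: with D = 2^(X+1) - 1,
    the power (2^v)^(X+1) = (1 + D)^v is 1 + v D modulo D^2 ([logn2E]). *)

(** * Binary digit sums *)

Local Open Scope nat_scope.

Lemma hammingE K N : N < 2 ^ K -> hamming N = \sum_(i < K) (N %/ 2 ^ i) %% 2.
Proof.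
have main a b : N < 2 ^ a -> a <= b ->
  \sum_(i < b) (N %/ 2 ^ i) %% 2 = \sum_(i < a) (N %/ 2 ^ i) %% 2.
  move=> ltN leab; rewrite -!(big_mkord xpredT (fun i => (N %/ 2 ^ i) %% 2)).
  rewrite (big_cat_nat (n := a)) //= [X in _ + X]big1_seq ?addn0 // => i.
  rewrite mem_index_iota => /andP[_ /andP[leai _]].
  by rewrite divn_small // (leq_trans ltN) ?leq_exp2l.
move=> ltN; rewrite /hamming.
have ltNN : N < 2 ^ N by apply: ltn_expl.
by case: (leqP K N) => [|/ltnW] le; [rewrite (main K) | rewrite -(main N K)].
Qed.

Lemma hamming_rec N : hamming N = N %% 2 + hamming (N %/ 2).
Proof.
have ltNN : N < 2 ^ N by apply: ltn_expl.
have ltN : N < 2 ^ N.+1 by rewrite expnS; lia.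
rewrite (hammingE ltN) big_ord_recl expn0 divn1; congr (_ + _).
rewrite (@hammingE N); first by apply: eq_bigr => i _; rewrite expnS divnMA.
by rewrite ltn_divLR // -expnSr.
Qed.

Lemma hamming0 : hamming 0 = 0.
Proof. by rewrite /hamming big_ord0. Qed.

Lemma hamming_cat k a b : b < 2 ^ k -> hamming (a * 2 ^ k + b) = hamming a + hamming b.
Proof.
elim: k b => [|k IHk] b; first by case: b => // _; rewrite muln1 addn0 hamming0 addn0.
move=> ltb; rewrite hamming_rec expnSr mulnA (hamming_rec b).
rewrite -modnDml modnMl add0n divnMDl // IHk; first lia.
by rewrite ltn_divLR // -expnSr.
Qed.

Lemma hamming_compl k c : c < 2 ^ k -> hamming (2 ^ k - 1 - c) + hamming c = k.
Proof.
elim: k c => [|k IHk] c ltc; first by case: c ltc => //; rewrite hamming0.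
have ltc2 : c %/ 2 < 2 ^ k by rewrite ltn_divLR // -expnSr.
rewrite -[in RHS](IHk _ ltc2) (hamming_rec (_ - _)) (hamming_rec c).
rewrite expnS in ltc *; move: (2 ^ k) ltc ltc2 => q ltc ltc2.
have -> : (2 * q - 1 - c) %/ 2 = q - 1 - c %/ 2 by lia.
suff : (2 * q - 1 - c) %% 2 + c %% 2 = 1 by lia.
lia.
Qed.

Lemma digit_sum_lt B L (d : 'I_L -> nat) : (forall j, d j < B) ->
  \sum_(j < L) d j * B ^ j < B ^ L.
Proof.
elim: L d => [|L IHL] d ltd; first by rewrite big_ord0.
rewrite big_ord_recr /= expnS.
apply: (@leq_trans ((d ord_max).+1 * B ^ L)).
  by rewrite mulSn ltn_add2r (IHL (fun j => d (widen_ord (leqnSn L) j))).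
by rewrite leq_mul2r ltd orbT.
Qed.

(** Digits in base [2 ^ K] occupy disjoint ranges of bits, so their weights add up. *)
Lemma hamming_blocks K L (d : 'I_L -> nat) : (forall j, d j < 2 ^ K) ->
  hamming (\sum_(j < L) d j * (2 ^ K) ^ j) = \sum_(j < L) hamming (d j).
Proof.
elim: L d => [|L IHL] d ltd; first by rewrite !big_ord0 hamming0.
rewrite !big_ord_recr /= addnC -expnM hamming_cat; last first.
  by rewrite expnM; exact: digit_sum_lt.
by rewrite IHL // addnC.
Qed.

(** For [f > 0], write [2 ^ w + 1 - f = c + 1] with [0 <= c < 2 ^ w]: then
    [(2 ^ w - 1) * (c + 1) = c * 2 ^ w + (2 ^ w - 1 - c)], a [w]-bit number followed by its
    complement, of total weight [w] whatever [c] is. *)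
Lemma hamming_digit w f : f <= 2 ^ w ->
  hamming ((2 ^ w - 1) * (2 ^ w + 1 - f)) = w + w * (f == 0).
Proof.
have w1 : 0 < 2 ^ w by rewrite expn_gt0.
have ones : hamming (2 ^ w - 1) = w.
  by have := hamming_compl w1; rewrite hamming0 subn0 addn0.
case: f => [|f] lef.
  have -> : (2 ^ w - 1) * (2 ^ w + 1 - 0) = (2 ^ w - 1) * 2 ^ w + (2 ^ w - 1) by nia.
  rewrite (@hamming_cat w) ?ones ?muln1 //; lia.
rewrite muln0 addn0 -[RHS](@hamming_compl w (2 ^ w - f.+1)); last lia.
rewrite [RHS]addnC -(@hamming_cat w); last lia.
congr hamming.
have [c ->] : exists c, 2 ^ w = f.+1 + c by exists (2 ^ w - f.+1); lia.
have -> : f.+1 + c + 1 - f.+1 = c.+1 by lia.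
have -> : f.+1 + c - 1 = f + c by lia.
have -> : f.+1 + c - f.+1 = c by lia.
have -> : f + c - c = f by lia.
ring.
Qed.

(** * The Hamming weight as a 2-adic valuation *)

Lemma logn2_odd h : logn 2 h.*2.+1 = 0.
Proof. by rewrite logn_coprime // coprime2n /= odd_double. Qed.

Lemma logn2_fact_double h : logn 2 (h.*2)`! = h + logn 2 h`!.
Proof.
elim: h => // h IHh; rewrite doubleS !factS !lognM ?muln_gt0 ?fact_gt0 //.
rewrite IHh logn2_odd -doubleS -mul2n lognM // logn_prime //; lia.
Qed.

(** Legendre's formula at the prime 2. *)
Lemma logn2_fact N : logn 2 N`! + hamming N = N.
Proof.
elim/ltn_ind: N => -[_|N IHN]; first by rewrite hamming0 logn1.
have /IHN {IHN} : N.+1 %/ 2 < N.+1 by apply: ltn_Pdiv.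
rewrite (hamming_rec N.+1).
suff -> : logn 2 N.+1`! = N.+1 %/ 2 + logn 2 (N.+1 %/ 2)`! by lia.
rewrite -logn2_fact_double divn2 -[in LHS](odd_double_half N.+1).
case: (odd N.+1) => //; rewrite add1n factS lognM ?fact_gt0 //.
by rewrite logn2_odd.
Qed.

(** Kummer's theorem for [N + N]: doubling [N] shifts its digits without changing their
    number of ones, so Legendre's formula for [2 N] and [N] leaves one weight of [N]. *)
Lemma hamming_logn N : hamming N = logn 2 'C(N.*2, N).
Proof.
have le : N <= N.*2 by lia.
have := congr1 (logn 2) (bin_fact le); rewrite !lognM ?muln_gt0 ?fact_gt0 ?bin_gt0 //.
have -> : N.*2 - N = N by lia.
rewrite logn2_fact_double; have := logn2_fact N; lia.
Qed.

(** * Numbers that encode a function on a cube *)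

Definition cube_index k t (x : {ffun 'I_k -> 'I_t}) : nat := \sum_(i < k) x i * t ^ i.

Lemma cube_index_lt k t (x : {ffun 'I_k -> 'I_t}) : cube_index x < t ^ k.
Proof. exact: digit_sum_lt (fun i => ltn_ord (x i)). Qed.

Lemma radix_inj k t (x y : nat -> nat) : (forall i, x i < t) -> (forall i, y i < t) ->
  \sum_(i < k) x i * t ^ i = \sum_(i < k) y i * t ^ i -> forall i, i < k -> x i = y i.
Proof.
move=> ltx lty; elim: k x y ltx lty => // k IHk x y ltx lty.
have shift (z : nat -> nat) : \sum_(i < k.+1) z i * t ^ i =
    (\sum_(i < k) z i.+1 * t ^ i) * t + z 0.
  rewrite big_ord_recl expn0 muln1 addnC big_distrl; congr (_ + _).
  by apply: eq_bigr => i _; rewrite /= expnSr mulnA.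
have t_gt0 : 0 < t by apply: leq_ltn_trans (ltx 0).
rewrite !shift => exy.
have e0 : x 0 = y 0.
  by have := congr1 (modn^~ t) exy; rewrite !modnMDl !modn_small.
case=> [//|i] lti; apply: (IHk (fun i => x i.+1) (fun i => y i.+1)) => //.
by have := congr1 (divn^~ t) exy; rewrite !divnMDl // !divn_small // !addn0.
Qed.

Lemma cube_index_inj k t : injective (@cube_index k t.+1).
Proof.
move=> x y exy; apply/ffunP => i; apply: val_inj => /=.
(* The digits are extended by 0 to all indices: [radix_inj] inducts on their number. *)
pose X (z : {ffun 'I_k -> 'I_t.+1}) j : nat := oapp z ord0 (insub j).
have ltX z j : X z j < t.+1 by rewrite /X; case: insubP.
have EX (z : {ffun 'I_k -> 'I_t.+1}) (j : 'I_k) : z j = X z j :> nat by rewrite /X valK.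
rewrite !EX; apply: (radix_inj (ltX x) (ltX y) _ (ltn_ord i)).
have XE z : \sum_(j < k) X z j * t.+1 ^ j = cube_index z.
  by apply: eq_bigr => j _; rewrite EX.
by rewrite !XE.
Qed.

(** Points of the cube and places [J < (t + 1) ^ k] correspond bijectively through
    [cube_index], so a sum over the cube is a numeral with digits [d x]. *)
Lemma hamming_cube K k t (d : {ffun 'I_k -> 'I_t.+1} -> nat) : (forall x, d x < 2 ^ K) ->
  hamming (\sum_x d x * (2 ^ K) ^ cube_index x) = \sum_x hamming (d x).
Proof.
move=> ltd; pose h x := Ordinal (@cube_index_lt k t.+1 x).
have [g hK gK] : bijective h.
  apply: inj_card_bij => [x y /(congr1 val)|]; first exact: cube_index_inj.
  by rewrite card_ord card_ffun !card_ord.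
have bij_g : {on xpredT, bijective g} by apply: onW_bij; exists h.
rewrite (reindex g) // [RHS](reindex g) // -(@hamming_blocks K) //.
congr hamming; apply: eq_bigr => j _; congr (_ * _ ^ _).
by rewrite -[in RHS](gK j).
Qed.

Local Open Scope ring_scope.

Definition mono_val k (mu : mono) (x : 'I_k -> nat) : int :=
  mcoef mu * \prod_(i < k)
    (nth 0 (mbase mu) i ^ (nth 0 (mbexp mu) i * x i) * x i ^ nth 0 (mpexp mu) i)%N%:Z.

(** The integer that [Aterm] multiplies by [- (2 ^ w - 1)]. *)
Definition mono_gsum k (t w : nat) (mu : mono) : int :=
  mcoef mu * \prod_(i < k)
    (Gsum (nth 0 (mpexp mu) i)
          (2 ^ (2 * w * t ^ i) * nth 0 (mbase mu) i ^ nth 0 (mbexp mu) i)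
          (t - 1))%N%:Z.

Lemma PoszX (a b : nat) : (a ^ b)%N%:Z = a%:Z ^+ b.
Proof. by elim: b => // b IHb; rewrite expnS exprS PoszM IHb. Qed.

(** Expanding the product of the sums over [j] amounts to choosing one [j = x i] for each
    variable, that is, a point of the cube. *)
Lemma mono_gsumE k t w mu : mono_gsum k t.+1 w mu =
  \sum_(x : {ffun 'I_k -> 'I_t.+1})
    mono_val mu (fun i => x i) * (2 ^+ (2 * w)) ^+ cube_index x.
Proof.
rewrite /mono_gsum subn1 /=.
under eq_bigr => i _ do rewrite /Gsum -[Posz _]intz sumMz.
rewrite (bigA_distr_bigA (fun i (j : 'I_t.+1) => _)) big_distrr /=; apply: eq_bigr => x _.
rewrite /mono_val -mulrA -exprM /cube_index big_distrr /= -prodrXr -big_split /=.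
congr (_ * _); apply: eq_bigr => i _; rewrite intz !PoszM !PoszX !PoszM !PoszX.
rewrite exprMn -!exprM mulrC [RHS]mulrAC; congr (_ * _); rewrite mulrC; congr (_ * _).
by congr (_ ^+ _); lia.
Qed.

(** For the monomial 1 the product of geometric sums telescopes: the factor of index [i]
    turns [q ^ (t ^ i) - 1] into [q ^ (t ^ i.+1) - 1], with [q = 2 ^ (2 w)]. *)
Lemma mono_gsum1E k t w :
  mono_gsum k t.+1 w (Mono 1 [::] [::] [::]) * (2 ^+ (2 * w) - 1) =
  2 ^+ (2 * w * t.+1 ^ k) - 1.
Proof.
rewrite /mono_gsum mul1r /=.
under eq_bigr => i _ do rewrite !nth_nil expn0 muln1 /Gsum subn1 /= -[Posz _]intz sumMz.
elim: k => [|k IHk]; first by rewrite big_ord0 mul1r muln1.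
have -> : (2 ^+ (2 * w * t.+1 ^ k.+1) - 1 : int) = (2 ^+ (2 * w * t.+1 ^ k)) ^+ t.+1 - 1.
  by rewrite -exprM expnSr mulnA.
rewrite big_ord_recr /= mulrAC IHk.
rewrite [RHS]subrX1; congr (_ * _); apply: eq_bigr => i _.
by rewrite intz expn0 mul1n !PoszX.
Qed.

Definition cube_sum t w (eps : int) (mus : seq mono) k : rat :=
  Cterm t w eps k + \sum_(mu <- mus) Aterm t w mu k.

(** The value of [cube_sum] as an integer: the exact division by [2 ^ w + 1] is carried out
    by writing [2 ^ (2 w) - 1 = (2 ^ w - 1) (2 ^ w + 1)] in the geometric sum of
    [mono_gsum1E]. *)
Definition cube_int t w (eps : int) (mus : seq mono) k : int :=
  (2 ^+ w - 1) * ((2 ^+ w - eps + 1) * mono_gsum k t w (Mono 1 [::] [::] [::])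
    - \sum_(mu <- mus) mono_gsum k t w mu).

Lemma cube_sum_int t w eps mus k : (0 < w)%N ->
  cube_sum t.+1 w eps mus k = (cube_int t.+1 w eps mus k)%:~R.
Proof.
move=> w_gt0; rewrite /cube_sum /cube_int intrM [X in _ * X]rmorphB /=.
rewrite [X in _ * (X - _)]intrM mulrBr; congr (_ + _).
  rewrite /Cterm -[2 ^+ _ - 1](_ : ((2 ^+ (2 * w * t.+1 ^ k) - 1) : int)%:~R = _); last first.
    by rewrite rmorphB rmorphXn.
  rewrite -mono_gsum1E; move: (mono_gsum _ _ _ _) => S.
  rewrite !(rmorphM, rmorphB, rmorphD, rmorphXn, rmorph1) /= mulnC exprM.
  have : (2 ^+ w + 1 : rat) != 0 by rewrite gt_eqF // ltr_wpDr // exprn_gt0.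
  move: (2 ^+ w : rat) (S%:~R : rat) => q s q1; field.
  exact: q1.
rewrite rmorph_sum /= -mulrN -sumrN big_distrr /=; apply: eq_bigr => mu _.
rewrite /Aterm /mono_gsum rmorphM rmorphB rmorphXn rmorph_prod /=.
by rewrite mulrN !mulNr -!mulrA.
Qed.

(** The digit encoding [f x] has weight [2 w] at the zeros of [f] and [w] elsewhere, so the
    Hamming weight of the encoding counts the zeros of [f]. *)
Theorem cube_count k t w (eps : int) (mus : seq mono) (f : {ffun 'I_k -> 'I_t.+1} -> nat) :
    (0 < w)%N -> (forall x, f x <= 2 ^ w)%N ->
    (forall x : {ffun 'I_k -> 'I_t.+1},
       eps + \sum_(mu <- mus) mono_val mu (fun i => x i) = (f x)%:Z) ->
  exists2 N : nat, cube_int t.+1 w eps mus k = N%:Z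
    & hamming N = (w * (t.+1 ^ k + #|[pred x | f x == 0%N]|))%N.
Proof.
move=> w_gt0 lef def_f.
pose d x := ((2 ^ w - 1) * (2 ^ w + 1 - f x))%N.
have w1 : (0 < 2 ^ w)%N by rewrite expn_gt0.
exists (\sum_x d x * (2 ^ (2 * w)) ^ cube_index x)%N.
  rewrite -[Posz _]intz sumMz /cube_int.
  under [\sum_(mu <- mus) _]eq_bigr => mu _ do rewrite mono_gsumE.
  rewrite mono_gsumE exchange_big /= big_distrr /= -sumrB big_distrr /=.
  apply: eq_bigr => x _; rewrite -big_distrl /= intz PoszM 2!PoszX.
  have -> : \sum_(mu <- mus) mono_val mu (fun i => x i) = (f x)%:Z - eps.
    by rewrite -def_f addrC addKr.
  have -> : mono_val (Mono 1 [::] [::] [::]) (fun i => x i) = 1.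
    by rewrite /mono_val mul1r big1 // => i _; rewrite !nth_nil.
  have -> : (d x)%:Z = (2 ^+ w - 1) * (2 ^+ w + 1 - (f x)%:Z).
    by rewrite /d PoszM -!subzn ?PoszD ?PoszX // (leq_trans (lef x)) ?leq_addr.
  ring.
rewrite hamming_cube => [|x].
  under eq_bigr => x _ do rewrite /d hamming_digit //.
  rewrite big_split /= sum_nat_const card_ffun !card_ord -big_distrr /=.
  by rewrite mulnDr mulnC -sum1_card [in RHS]big_mkcond.
rewrite /d mulnC (mulnC 2) expnM -mulnn.
by have := lef x; move: (2 ^ w)%N (f x) w1; nia.
Qed.

Local Open Scope nat_scope.

(** * Closed forms: binomial coefficients, gcds, valuations and power sums *)

(** Reading a coefficient off the value of a polynomial at [B]: its coefficients, here the
    sums of the [c i] with [e i] fixed, are less than [B], so they do not overlap. *)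
Lemma gen_fun_digit (I : finType) (c e : I -> nat) B n : \sum_i c i < B ->
  (\sum_i c i * B ^ e i) %/ B ^ n %% B = \sum_(i | e i == n) c i.
Proof.
move=> ltcB; have B_gt0 : 0 < B by apply: leq_ltn_trans ltcB.
have sub_lt (P : pred I) : \sum_(i | P i) c i < B.
  apply: leq_ltn_trans ltcB; rewrite [leqRHS](bigID P) /=; exact: leq_addr.
rewrite (bigID (fun i => e i < n)) /=; set lo := \sum_(i | e i < n) _.
have lt_lo : lo < B ^ n.
  rewrite -(ltn_pmul2r B_gt0); apply: (@leq_ltn_trans (B ^ n * \sum_(i | e i < n) c i)).
    rewrite /lo big_distrl big_distrr; apply: leq_sum => i lt_in /=.
    by rewrite -mulnA -expnSr mulnC leq_mul2r leq_pexp2l ?orbT.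
  by rewrite ltn_pmul2l ?sub_lt // expn_gt0 B_gt0.
rewrite (bigID (fun i => e i == n)) /=.
have -> : \sum_(i | ~~ (e i < n) && (e i == n)) c i * B ^ e i =
    (\sum_(i | e i == n) c i) * B ^ n.
  rewrite big_distrl; apply: eq_big => [i|i /andP[_ /eqP->] //].
  by case: eqP => [->|]; rewrite ?ltnn ?andbF.
have -> : \sum_(i | ~~ (e i < n) && (e i != n)) c i * B ^ e i =
    (\sum_(i | ~~ (e i < n) && (e i != n)) c i * B ^ (e i - n.+1)) * B * B ^ n.
  rewrite !big_distrl; apply: eq_bigr => i; rewrite -leqNgt => /andP[le_ni ne_in] /=.
  rewrite -!mulnA -expnS -expnD subnK //; lia.
rewrite -mulnDl addnC divnMDl ?expn_gt0 ?B_gt0 // divn_small // addn0.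
by rewrite addnC modnMDl modn_small.
Qed.

Lemma bin_digit a b : 'C(a, b) = (2 ^ a + 1 + 1) ^ a %/ (2 ^ a + 1) ^ b %% (2 ^ a + 1).
Proof.
set B := 2 ^ a + 1; rewrite addnC expnDn.
under eq_bigr => i _ do rewrite exp1n mul1n.
have sumC : \sum_(i < a.+1) 'C(a, i) = 2 ^ a.
  by rewrite -[2]/(1 + 1) expnDn; apply: eq_bigr => i _; rewrite !exp1n !muln1.
rewrite (@gen_fun_digit _ (fun i : 'I_a.+1 => 'C(a, i)) (@nat_of_ord _)); last first.
  by rewrite sumC /B addn1.
case: (ltnP b a.+1) => [ltb | ltab].
  by rewrite (big_pred1 (Ordinal ltb)).
rewrite bin_small // big1 // => i /eqP eib.
by have := ltn_ord i; rewrite [X in X < _]eib ltnNge ltab.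
Qed.

(** The equation is [a (i + 1) + b j = a b]: it determines [j] from [i], and it is solvable
    in [j] exactly when [b / gcd(a, b)] divides [i + 1], which happens [gcd(a, b)] times for
    [i < b]. *)
Lemma gcdn_count a b : 0 < a -> 0 < b ->
  \sum_(p : 'I_b * 'I_a | a * p.1 + b * p.2 == a * (b - 1)) 1 = gcdn a b.
Proof.
move=> a_gt0 b_gt0; rewrite big_mkcond.
rewrite -(pair_bigA _ (fun (i : 'I_b) (j : 'I_a) =>
  if a * i + b * j == a * (b - 1) then 1 else 0)) /=.
have g_gt0 : 0 < gcdn a b by rewrite gcdn_gt0 a_gt0.
have [a' [b' [co ea eb]]] : exists a' b', [/\ coprime b' a',
    a = gcdn a b * a' & b = gcdn a b * b'].
  exists (a %/ gcdn a b), (b %/ gcdn a b).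
  split; first 1 last.
  - by rewrite mulnC divnK ?dvdn_gcdl.
  - by rewrite mulnC divnK ?dvdn_gcdr.
  rewrite coprime_sym /coprime -(eqn_pmul2l g_gt0) muln_gcdr muln1.
  by rewrite ![_ * (_ %/ _)]mulnC !divnK ?dvdn_gcdl ?dvdn_gcdr.
have b'_gt0 : 0 < b' by move: b_gt0; rewrite eb muln_gt0 => /andP[].
transitivity (\sum_(i < b) (b' %| i.+1)); last first.
  have -> : gcdn a b = b %/ b' by rewrite [X in X %/ _]eb mulnK.
  by rewrite divn_count_dvd big_add1 big_mkord.
apply: eq_bigr => i _; rewrite -big_mkcond /=.
have -> : (b' %| i.+1) = (b %| a * i.+1).
  by rewrite [in RHS]ea [X in _ = (X %| _)]eb -mulnA dvdn_pmul2l // Gauss_dvdr.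
have eqE (j : 'I_a) : (a * i + b * j == a * (b - 1)) = (a * i.+1 + b * j == b * a).
  by rewrite mulnS mulnBr muln1 (mulnC b a); have := leq_pmulr a b_gt0; lia.
under eq_bigl => j do rewrite eqE.
case: (boolP (b %| _)) => [/dvdnP[c ec]|ndv]; last first.
  rewrite big1 // => j /eqP ej; case/negP: ndv.
  by rewrite -(dvdn_addl _ (dvdn_mulr j (dvdnn b))) ej dvdn_mulr.
have c_gt0 : 0 < c by case: c ec => //; rewrite mul0n => /eqP; rewrite muln_eq0 gtn_eqF.
have le_ca : c <= a.
  by rewrite -(leq_pmul2r b_gt0) -ec leq_mul2l ltn_ord orbT.
have lt_ac : a - c < a by lia.
rewrite (big_pred1 (Ordinal lt_ac)) // => j; rewrite ec (mulnC c) -mulnDr.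
rewrite eqn_pmul2l //; apply/eqP/eqP => [ej|-> /=]; last lia.
by apply: val_inj => /=; lia.
Qed.

(** The product of the geometric sums of ratios [B ^ a] and [B ^ b] is the generating function
    of [a i + b j]; its coefficients are at most the number [a b] of pairs, whence [B]. *)
Lemma gcdn_digit a b : 0 < a -> 0 < b ->
  gcdn a b = let B := b * a + 1 in
    Gsum 0 (B ^ a) (b - 1) * Gsum 0 (B ^ b) (a - 1) %/ B ^ (a * (b - 1)) %% B.
Proof.
move=> a_gt0 b_gt0 /=; set B := b * a + 1; rewrite /Gsum !subn1 !prednK // -subn1.
rewrite big_distrlr /= pair_bigA /= -gcdn_count //.
under [in RHS]eq_bigr => p _ do rewrite !mul1n -!expnM -expnD -[B ^ _]mul1n.
by rewrite gen_fun_digit // sum1_card card_prod !card_ord /B addn1.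
Qed.

Lemma expn_succ_mod D v : (D + 1) ^ v = v * D + 1 %[mod D ^ 2].
Proof.
elim: v => // v IHv; rewrite expnSr -modnMml IHv modnMml.
rewrite (_ : (_ * _) = v * D ^ 2 + (v.+1 * D + 1)) ?modnMDl //; ring.
Qed.

Lemma gcdn_exp2 X : 0 < X -> gcdn X (2 ^ X) = 2 ^ logn 2 X.
Proof.
move=> X_gt0; have le : logn 2 X <= X by apply/ltnW/ltn_logl.
have [m co_m {1}->] := pfactor_coprime (isT : prime 2) X_gt0.
rewrite -{2}(subnK le) expnD -muln_gcdl mulnC.
suff /eqP-> : coprime m (2 ^ (X - logn 2 X)) by rewrite muln1.
by rewrite coprime_sym coprimeXl.
Qed.

(** With [v = logn 2 X], the power [(2 ^ v) ^ (X + 1)] is [(1 + D) ^ v], which is [1 + v D]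
    modulo [D ^ 2]; both [1 + v D < D ^ 2] and [1 < D] because [v < X < D]. *)
Lemma logn2E X : 0 < X ->
  let D := 2 ^ (X + 1) - 1 in
  logn 2 X = gcdn X (2 ^ X) ^ (X + 1) %% D ^ 2 %/ D.
Proof.
move=> X_gt0 D; rewrite gcdn_exp2 // -expnM mulnC expnM.
have ltv : logn 2 X < X by apply: ltn_logl.
have ltX : X < 2 ^ X by apply: ltn_expl.
have leD : X < D by rewrite /D addn1 expnS; lia.
have -> : 2 ^ (X + 1) = D + 1 by rewrite /D subnK // expn_gt0.
rewrite expn_succ_mod modn_small; last by rewrite -mulnn; nia.
rewrite divnMDl; last lia.
by rewrite divn_small ?addn0; lia.
Qed.

(** Summing [(j + 1) ^ r q ^ (j + 1) - j ^ r q ^ j] over [j] telescopes, and by the binomial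
    theorem this difference is
    [(q - 1) j ^ r q ^ j + q * \sum_(i < r) 'C(r, i) j ^ i q ^ j].  The term [0 ^ r] is the
    lower end of the telescope. *)
Lemma Gsum_rec r q s : 0 < q ->
  (q - 1) * Gsum r q s + q * \sum_(i < r) 'C(r, i) * Gsum i q s + 0 ^ r =
  (s + 1) ^ r * q ^ (s + 1).
Proof.
case: q => // q _; rewrite subn1 /= addn1 /Gsum; elim: s.+1 => [|n IHn].
  rewrite big_ord0 muln0 add0n big1 ?muln0 ?muln1 // => i _.
  by rewrite big_ord0 muln0.
under eq_bigr => i _ do rewrite big_ord_recr mulnDr mulnA /=.
rewrite big_ord_recr big_split /= -big_distrl /=.
have -> : n.+1 ^ r = \sum_(i < r) 'C(r, i) * n ^ i + n ^ r.
  rewrite -add1n expnDn big_ord_recr /= exp1n binn !mul1n; congr (_ + _).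
  by apply: eq_bigr => i _; rewrite exp1n mul1n.
rewrite expnS; move: IHn; move: (q.+1 ^ n) (n ^ r) => Q N.
move: (\sum_(i < r) 'C(r, i) * n ^ i) => S.
move: (\sum_(j < n) _) (\sum_(i < r) _) (0 ^ r) => A T z IHn.
rewrite mulnDr mulnDr mulnDl -[RHS]addnC mulnA [q.+1 * (S * Q)]mulnCA; lia.
Qed.

(** * Functions given by arithmetic terms *)

Section Representable.

Variables (k : nat) (D : ('I_k -> nat) -> Prop).
Implicit Types F G : ('I_k -> nat) -> nat.

(** Values are prescribed on a domain [D] only, since closed forms hold under side conditions
    such as the positivity of a divisor. *)
Definition representable F := exists e : aterm k, forall v, D v -> aeval v e = F v.

Lemma representable_ext F G :
  (forall v, D v -> F v = G v) -> representable F -> representable G.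
Proof. by move=> eFG [e eE]; exists e => v Dv; rewrite eE ?eFG. Qed.

Lemma representable_cst c : representable (fun=> c).
Proof. by exists (ACst k c). Qed.

Lemma representable_var i : representable (fun v => v i).
Proof. by exists (AVar i). Qed.

Lemma representable_add F G :
  representable F -> representable G -> representable (fun v => F v + G v).
Proof. by move=> [e eE] [f fE]; exists (AAdd e f) => v Dv /=; rewrite eE ?fE. Qed.

Lemma representable_sub F G :
  representable F -> representable G -> representable (fun v => F v - G v).
Proof. by move=> [e eE] [f fE]; exists (ASub e f) => v Dv /=; rewrite eE ?fE. Qed.

Lemma representable_div F G :
  representable F -> representable G -> representable (fun v => F v %/ G v).
Proof. by move=> [e eE] [f fE]; exists (ADiv e f) => v Dv /=; rewrite eE ?fE. Qed.

Lemma representable_exp F G :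
  representable F -> representable G -> representable (fun v => F v ^ G v).
Proof. by move=> [e eE] [f fE]; exists (APow e f) => v Dv /=; rewrite eE ?fE. Qed.

(** Squares are powers, and products come from squares by polarization. *)
Lemma representable_mul F G :
  representable F -> representable G -> representable (fun v => F v * G v).
Proof.
move=> repF repG; have rep2 := representable_cst 2.
apply: (@representable_ext (fun v => ((F v + G v) ^ 2 - F v ^ 2 - G v ^ 2) %/ 2)).
  by move=> v _; rewrite sqrnD -addnA !addKn mulKn.
apply: representable_div => //; apply: representable_sub; last exact: representable_exp.
apply: representable_sub; last exact: representable_exp.
by apply: representable_exp => //; apply: representable_add.
Qed.

Lemma representable_mod F G :
  representable F -> representable G -> representable (fun v => F v %% G v).
Proof.
move=> repF repG; apply: (@representable_ext (fun v => F v - F v %/ G v * G v)).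
  by move=> v _; rewrite {1}(divn_eq (F v) (G v)) addKn.
by apply: representable_sub => //; apply/representable_mul => //; apply: representable_div.
Qed.

Lemma representable_sum n (Fs : nat -> ('I_k -> nat) -> nat) :
  (forall i, i < n -> representable (Fs i)) -> representable (fun v => \sum_(i < n) Fs i v).
Proof.
elim: n => [|n IHn] repF.
  by apply: representable_ext (representable_cst 0) => v _; rewrite big_ord0.
apply: (@representable_ext (fun v => \sum_(i < n) Fs i v + Fs n v)).
  by move=> v _; rewrite big_ord_recr.
by apply: representable_add; [apply: IHn => i ltin|]; apply: repF => //; apply: ltnW.
Qed.

Lemma representable_prod n (Fs : nat -> ('I_k -> nat) -> nat) :
  (forall i, i < n -> representable (Fs i)) -> representable (fun v => \prod_(i < n) Fs i v).
Proof.
elim: n => [|n IHn] repF.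
  by apply: representable_ext (representable_cst 1) => v _; rewrite big_ord0.
apply: (@representable_ext (fun v => (\prod_(i < n) Fs i v) * Fs n v)).
  by move=> v _; rewrite big_ord_recr.
by apply: representable_mul; [apply: IHn => i ltin|]; apply: repF => //; apply: ltnW.
Qed.

Lemma representable_bin F G :
  representable F -> representable G -> representable (fun v => 'C(F v, G v)).
Proof.
move=> repF repG; apply: (@representable_ext
  (fun v => (2 ^ F v + 1 + 1) ^ F v %/ (2 ^ F v + 1) ^ G v %% (2 ^ F v + 1))).
  by move=> v _; rewrite -bin_digit.
have repB : representable (fun v => 2 ^ F v + 1).
  apply: representable_add (representable_cst 1).
  exact: representable_exp (representable_cst 2) repF.
apply: representable_mod => //; apply: representable_div; apply: representable_exp => //.
exact: representable_add (representable_cst 1).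
Qed.

Lemma representable_Gsum r F G : (forall v, D v -> 1 < F v) ->
  representable F -> representable G -> representable (fun v => Gsum r (F v) (G v)).
Proof.
move=> F_gt1 repF repG; elim/ltn_ind: r => r IHr.
pose S v := F v * \sum_(i < r) 'C(r, i) * Gsum i (F v) (G v).
apply: (@representable_ext
  (fun v => ((G v + 1) ^ r * F v ^ (G v + 1) - 0 ^ r - S v) %/ (F v - 1))).
  move=> v Dv; have := Gsum_rec r (G v) (ltnW (F_gt1 v Dv)) => <-.
  by rewrite addnK addnK mulKn // subn_gt0 F_gt1.
have rep1 := representable_cst 1; have repG1 := representable_add repG rep1.
apply: representable_div; last exact: representable_sub.
apply: representable_sub.
  apply: representable_sub (representable_cst _).
  by apply: representable_mul; apply: representable_exp => //; apply: representable_cst.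
apply: representable_mul => //.
apply: (@representable_sum r (fun i v => 'C(r, i) * Gsum i (F v) (G v))) => i lt_ir.
by apply: representable_mul; [apply: representable_cst | apply: IHr].
Qed.

Lemma representable_gcd F G : (forall v, D v -> 0 < F v) -> (forall v, D v -> 0 < G v) ->
  representable F -> representable G -> representable (fun v => gcdn (F v) (G v)).
Proof.
move=> F_gt0 G_gt0 repF repG.
apply: (@representable_ext (fun v => let B := G v * F v + 1 in
    Gsum 0 (B ^ F v) (G v - 1) * Gsum 0 (B ^ G v) (F v - 1)
      %/ B ^ (F v * (G v - 1)) %% B)).
  by move=> v Dv; rewrite gcdn_digit ?F_gt0 ?G_gt0.
have rep1 := representable_cst 1.
have repB : representable (fun v => G v * F v + 1).
  by apply: representable_add => //; apply: representable_mul.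
have B_gt1 H v : D v -> 0 < H v -> 1 < (G v * F v + 1) ^ H v.
  move=> Dv H_gt0; apply: leq_ltn_trans H_gt0 (ltn_expl _ _).
  by rewrite addn1 ltnS muln_gt0 F_gt0 ?G_gt0.
apply: representable_mod => //; apply: representable_div.
  apply: representable_mul; apply: representable_Gsum.
  - by move=> v Dv; apply: B_gt1 => //; apply: F_gt0.
  - exact: representable_exp.
  - exact: representable_sub.
  - by move=> v Dv; apply: B_gt1 => //; apply: G_gt0.
  - exact: representable_exp.
  - exact: representable_sub.
apply: representable_exp => //; apply: representable_mul => //.
exact: representable_sub.
Qed.

Lemma representable_logn2 F : (forall v, D v -> 0 < F v) ->
  representable F -> representable (fun v => logn 2 (F v)).
Proof.
move=> F_gt0 repF.
apply: (@representable_ext (fun v => let D' := 2 ^ (F v + 1) - 1 in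
    gcdn (F v) (2 ^ F v) ^ (F v + 1) %% D' ^ 2 %/ D')).
  by move=> v Dv; rewrite logn2E ?F_gt0.
have rep1 := representable_cst 1; have rep2 := representable_cst 2.
have repF1 : representable (fun v => F v + 1) by apply: representable_add.
have repD : representable (fun v => 2 ^ (F v + 1) - 1).
  by apply: representable_sub => //; apply: representable_exp.
apply: representable_div => //; apply: representable_mod; last exact: representable_exp.
apply: representable_exp => //; apply: representable_gcd => //.
  by move=> v _; rewrite expn_gt0.
exact: representable_exp.
Qed.

Lemma representable_hamming F : representable F -> representable (fun v => hamming (F v)).
Proof.
move=> repF; apply: (@representable_ext (fun v => logn 2 'C((F v).*2, F v))).
  by move=> v _; rewrite hamming_logn.
apply: representable_logn2 => [v _|]; first by rewrite bin_gt0 -addnn leq_addr.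
apply: representable_bin => //.
by apply: representable_ext (representable_add repF repF) => v _; rewrite addnn.
Qed.

Local Open Scope ring_scope.

(** Term operations have truncated subtraction; a difference of two representable functions
    stands for an integer-valued one, and such differences are closed under the ring
    operations. *)
Definition int_representable (z : ('I_k -> nat) -> int) :=
  exists F G, [/\ representable F, representable G &
                  forall v, D v -> z v = (F v)%:Z - (G v)%:Z].

Lemma int_representable_ext y z :
  (forall v, D v -> y v = z v) -> int_representable y -> int_representable z.
Proof.
by move=> eyz [F [G [repF repG yE]]]; exists F, G; split=> // v Dv; rewrite -eyz ?yE.
Qed.

Lemma int_representable_nat F : representable F -> int_representable (fun v => (F v)%:Z).
Proof.
move=> repF; exists F, (fun=> 0%N); split=> // [|v _]; first exact: representable_cst.
by rewrite subr0.
Qed.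

Lemma int_representable_opp y : int_representable y -> int_representable (fun v => - y v).
Proof.
move=> [F [G [repF repG yE]]]; exists G, F; split=> // v Dv.
by rewrite yE // opprB.
Qed.

Lemma int_representable_add y z : int_representable y -> int_representable z ->
  int_representable (fun v => y v + z v).
Proof.
move=> [F [G [repF repG yE]]] [F' [G' [repF' repG' zE]]].
exists (fun v => F v + F' v)%N, (fun v => G v + G' v)%N.
split=> [||v Dv]; try exact: representable_add.
by rewrite yE // zE // !PoszD; ring.
Qed.

Lemma int_representable_mul y z : int_representable y -> int_representable z ->
  int_representable (fun v => y v * z v).
Proof.
move=> [F [G [repF repG yE]]] [F' [G' [repF' repG' zE]]].
exists (fun v => F v * F' v + G v * G' v)%N, (fun v => F v * G' v + G v * F' v)%N.
split=> [||v Dv]; try by apply: representable_add; apply: representable_mul.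
by rewrite yE // zE // !PoszD !PoszM; ring.
Qed.

Lemma int_representableP F : int_representable (fun v => (F v)%:Z) -> representable F.
Proof.
move=> [G [H [repG repH FE]]]; apply: representable_ext (representable_sub repG repH).
by move=> v /FE; lia.
Qed.

Lemma int_representable_big_cons (I : Type) (h : ('I_k -> nat) -> I -> int) f s :
  int_representable (fun v => h v (f v)) ->
  int_representable (fun v => \sum_(i <- s v) h v i) ->
  int_representable (fun v => \sum_(i <- f v :: s v) h v i).
Proof.
move=> repf reps; apply: int_representable_ext (int_representable_add repf reps).
by move=> v _; rewrite big_cons.
Qed.

Lemma int_representable_big_nil (I : Type) (h : ('I_k -> nat) -> I -> int) :
  int_representable (fun v => \sum_(i <- [::]) h v i).
Proof.
apply: int_representable_ext (int_representable_nat (representable_cst 0)).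
by move=> v _; rewrite big_nil.
Qed.

Lemma int_representable_mono_gsum l t w (c : ('I_k -> nat) -> int)
    (b : ('I_k -> nat) -> seq nat) be pe :
    (forall v, D v -> (0 < t v)%N /\ (0 < w v)%N) ->
    (forall v i, D v -> (0 < nth 0%N (b v) i ^ nth 0%N be i)%N) ->
    representable t -> representable w -> int_representable c ->
    (forall i, representable (fun v => nth 0%N (b v) i ^ nth 0%N be i)%N) ->
  int_representable (fun v => mono_gsum l (t v) (w v) (Mono (c v) (b v) be pe)).
Proof.
move=> tw_gt0 b_gt0 rept repw repc repb; apply: int_representable_mul => //=.
pose q i v := (2 ^ (2 * w v * t v ^ i) * nth 0 (b v) i ^ nth 0 be i)%N.
pose Fs i v := Gsum (nth 0%N pe i) (q i v) (t v - 1)%N.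
apply: (@int_representable_ext (fun v => (\prod_(i < l) Fs i v)%N%:Z)).
  by move=> v _; rewrite -[Posz _]intz prodMz; apply: eq_bigr => i _; rewrite intz.
apply: int_representable_nat; apply: representable_prod => i _.
apply: representable_Gsum => [v Dv||].
- have [t_gt0 w_gt0] := tw_gt0 v Dv; rewrite /q.
  apply: leq_trans (leq_pmulr _ (b_gt0 v i Dv)).
  by rewrite -{1}(expn0 2) ltn_exp2l // !muln_gt0 w_gt0 expn_gt0 t_gt0.
- apply: representable_mul => //; apply: representable_exp (representable_cst 2) _.
  apply: representable_mul; first exact: representable_mul (representable_cst 2) repw.
  exact: representable_exp rept (representable_cst i).
- exact: representable_sub rept (representable_cst 1).
Qed.

End Representable.

Local Open Scope nat_scope.

(** * The zeros counted by the multiplicative order *)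

Lemma mult_ord_gt0 m n : 0 < mult_ord m n.
Proof. by rewrite /mult_ord; case: ex_minnP => r /andP[]. Qed.

Lemma dvdn_mult_ord m n r : coprime m n -> (mult_ord m n %| r) = (m ^ r == 1 %[mod n]).
Proof.
move=> co_mn; rewrite /mult_ord; case: ex_minnP => o.
rewrite co_mn /= => /andP[o_gt0 /eqP ord_o] min_o.
have -> : (m ^ r == 1 %[mod n]) = (m ^ (r %% o) == 1 %[mod n]).
  rewrite {1}(divn_eq r o) expnD mulnC (mulnC _ o) expnM -modnMmr -modnXm ord_o.
  by rewrite modnXm exp1n modnMmr muln1.
have ltro : r %% o < o by apply: ltn_pmod.
rewrite /dvdn; case: (posnP (r %% o)) => [->|r_gt0]; first by rewrite expn0 !eqxx.
apply/esym/idP => ord_r; have := min_o (r %% o); rewrite r_gt0 ord_r leqNgt ltro.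
by move/(_ isT).
Qed.

Lemma card_succ_dvdn o P : #|[pred r : 'I_P | o %| r.+1]| = P %/ o.
Proof.
rewrite divn_count_dvd big_add1 big_mkord -sum1_card big_mkcond.
by apply: eq_bigr => i _; rewrite inE; case: ifP.
Qed.

(** If [N = q o + r] with [r < o <= q], then the quotient of [N] by [q] is [o] again. *)
Lemma divn_divn_small N o : o <= N %/ o -> N %/ (N %/ o) = o.
Proof.
move=> le; case: (posnP o) => [->|o_gt0]; first by rewrite !divn0.
rewrite {1}(divn_eq N o) mulnC divnMDl ?(leq_trans o_gt0 le) //.
by rewrite divn_small ?addn0 // (leq_trans (ltn_pmod _ o_gt0) le).
Qed.

Local Open Scope ring_scope.

Local Notation o1 := (lift ord0 ord0 : 'I_4).
Local Notation o2 := (lift ord0 (lift ord0 ord0) : 'I_4).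
Local Notation o3 := (lift ord0 (lift ord0 (lift ord0 ord0)) : 'I_4).

(** The arguments [x ord0], [x o1], [x o2], [x o3] are the variables numbered from 1 to 4.
    The last two squares bound the first variable: with natural numbers [x o3] and [x o2]
    they force [x ord0 <= P] and [1 <= x ord0].  The parameter [P] is the totient of [n] in
    the formula for the order and [n ^ 2] in the arithmetic term. *)
Definition ord_poly (m n P : nat) (x : 'I_4 -> nat) : int :=
  (m%:Z ^+ x ord0 - 1 - n%:Z * (x o1)%:Z) ^+ 2
  + (P%:Z - (x ord0)%:Z - (x o3)%:Z) ^+ 2
  + ((x ord0)%:Z - 1 - (x o2)%:Z) ^+ 2.

Definition ord_monos (m n P : nat) : seq mono :=
  [:: Mono (2 * n%:Z) [::] [::] [:: 0; 1]%N;
      Mono 2 [::] [::] [:: 2]%N;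
      Mono (- (2 * (P%:Z + 1))) [::] [::] [:: 1]%N;
      Mono (- (2 * n%:Z)) [:: m] [:: 1]%N [:: 0; 1]%N;
      Mono 2 [::] [::] [:: 0; 0; 1]%N;
      Mono (n%:Z ^+ 2) [::] [::] [:: 0; 2]%N;
      Mono (- (2 * P%:Z)) [::] [::] [:: 0; 0; 0; 1]%N;
      Mono (- 2) [:: m] [:: 1]%N [::];
      Mono (- 2) [::] [::] [:: 1; 0; 1]%N;
      Mono 1 [::] [::] [:: 0; 0; 2]%N;
      Mono 1 [:: m] [:: 2]%N [::];
      Mono 2 [::] [::] [:: 1; 0; 0; 1]%N;
      Mono 1 [::] [::] [:: 0; 0; 0; 2]%N].

Lemma ord_polyE m n P (x : 'I_4 -> nat) :
  P%:Z ^+ 2 + 2 + \sum_(mu <- ord_monos m n P) mono_val mu x = ord_poly m n P x.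
Proof.
rewrite /ord_monos !big_cons big_nil /mono_val !big_ord_recl !big_ord0 /=.
rewrite /ord_poly !PoszM !PoszX /= !mul0n !mul1n (mulnC 2) exprM.
move: (x ord0) (x o1) (x o2) (x o3) => a b c d.
move: (m%:Z ^+ a) => ma; ring.
Qed.

Lemma ord_M_cube m n : ord_M m n =
  cube_sum (ord_t m n) (ord_w m n) ((totient n)%:Z ^+ 2 + 2) (ord_monos m n (totient n)) 4.
Proof.
have addr_big_cons c (mu : mono) s F : c + \sum_(nu <- mu :: s) F nu =
    c + F mu + \sum_(nu <- s) F nu :> rat by rewrite big_cons addrA.
by rewrite /cube_sum /ord_monos !addr_big_cons big_nil addr0.
Qed.

Lemma ord_poly_ge0 m n P x : 0 <= ord_poly m n P x.
Proof. by rewrite !addr_ge0 ?sqr_ge0. Qed.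

(** Let [T = m ^ P] and [E = 2 ^ (m T)], so that [2 ^ w = 4 E ^ 2].  On the cube each of the
    three squared quantities is at most [E] in absolute value: the powers of [m] because
    [m <= 2 ^ m], the other terms because they are at most [T ^ 2 + 1 <= 4 ^ T].  So [f] is
    at most [3 E ^ 2]. *)
Lemma ord_poly_le m n P (x : 'I_4 -> nat) : (2 <= m)%N -> (n <= m ^ P)%N ->
    (forall i, x i <= m ^ P)%N ->
  (`|ord_poly m n P x| <= 2 ^ (2 * m ^ (P + 1) + 2))%N.
Proof.
move=> m_gt1 le_nT lexT; have le_PT : (P <= m ^ P)%N by apply/ltnW/ltn_expl.
pose E := (2 ^ (m ^ (P + 1)))%N.
have -> : (2 ^ (2 * m ^ (P + 1) + 2) = 4 * E ^ 2)%N.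
  rewrite /E expnD mulnC [X in (_ * 2 ^ X)%N]mulnC expnM; congr (_ * _)%N.
have T_gt0 : (0 < m ^ P)%N by rewrite expn_gt0 (ltnW m_gt1).
rewrite /E {E} addn1 (expnS m).
move: (m ^ P)%N T_gt0 le_nT le_PT lexT => T T_gt0 le_nT le_PT lexT.
have leTE : (T * T + 1 <= 2 ^ (m * T))%N.
  apply: (@leq_trans (2 ^ (2 * T))%N); last by rewrite leq_exp2l // leq_mul2r m_gt1 orbT.
  rewrite mulnC expnM -mulnn; have := ltn_expl T (isT : 1 < 2)%N.
  by move: (2 ^ T)%N => q ltTq; nia.
have lemE : (m ^ x ord0 <= 2 ^ (m * T))%N.
  apply: (@leq_trans (m ^ T)%N); first by rewrite leq_pexp2l ?lexT //; lia.
  by rewrite expnM leq_exp2r //; apply/ltnW/ltn_expl.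
have m1 : (0 < m ^ x ord0)%N by rewrite expn_gt0; lia.
move: (2 ^ (m * T))%N leTE lemE => E leTE lemE.
have le_sqr (u : int) : - E%:Z <= u <= E%:Z -> u ^+ 2 <= E%:Z ^+ 2.
  by move=> /andP[lo hi]; nia.
have le1 : (n * x o1 <= T * T)%N by apply: leq_mul.
rewrite -lez_nat gez0_abs ?ord_poly_ge0 // PoszM PoszX /ord_poly -PoszX -PoszM.
have := lexT ord0; have := lexT o2; have := lexT o3.
move: (m ^ x ord0)%N (n * x o1)%N m1 lemE le1 => ma nb m1 lema lenb.
move: (x ord0) (x o2) (x o3) => a c d led lec lea.
have leT2 : (2 * T <= E)%N by apply: leq_trans leTE; nia.
have leT1 : (T + 1 <= E)%N by lia.
have h1 : (ma%:Z - 1 - nb%:Z) ^+ 2 <= E%:Z ^+ 2.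
  by apply: le_sqr; apply/andP; split; lia.
have h2 : (P%:Z - a%:Z - d%:Z) ^+ 2 <= E%:Z ^+ 2.
  by apply: le_sqr; apply/andP; split; lia.
have h3 : (a%:Z - 1 - c%:Z) ^+ 2 <= E%:Z ^+ 2.
  by apply: le_sqr; apply/andP; split; lia.
by move: h1 h2 h3 (sqr_ge0 E%:Z); lra.
Qed.

Lemma ord_poly_eq0 m n P (x : 'I_4 -> nat) : (0 < m)%N ->
  (ord_poly m n P x == 0) =
  [&& m ^ x ord0 == n * x o1 + 1, x ord0 + x o3 == P & x ord0 == x o2 + 1]%N.
Proof.
move=> m_gt0; rewrite /ord_poly !paddr_eq0 ?addr_ge0 ?sqr_ge0 // !sqrf_eq0 -andbA.
rewrite -PoszX -PoszM; congr [&& _, _ & _]; apply/eqP/eqP; lia.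
Qed.

(** The zeros are the points [(r, (m ^ r - 1) / n, r - 1, P - r)] for the exponents [r]
    between 1 and [P] that the order divides; the proof numbers them by [r - 1]. *)
Lemma card_ord_poly m n P : (2 <= m)%N -> (1 < n)%N -> coprime m n ->
  #|[pred x : {ffun 'I_4 -> 'I_(m ^ P).+1} | `|ord_poly m n P (fun i => x i)|%N == 0%N]| =
  (P %/ mult_ord m n)%N.
Proof.
move=> m_gt1 n_gt1 co_mn; have m_gt0 : (0 < m)%N by lia.
pose h (r : 'I_P) : {ffun 'I_4 -> 'I_(m ^ P).+1} := [ffun i => nth ord0
  [:: inord r.+1; inord ((m ^ r.+1 - 1) %/ n); inord r; inord (P - r.+1)] (val i)].
have ltPT : (P < m ^ P)%N by apply: ltn_expl.
have hE (r : 'I_P) : [/\ h r ord0 = r.+1 :> nat, h r o1 = ((m ^ r.+1 - 1) %/ n)%N :> nat,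
    h r o2 = r :> nat & h r o3 = (P - r.+1)%N :> nat].
  have ltrP := ltn_ord r; rewrite !ffunE /= !inordK //; try lia.
  rewrite ltnS; apply: leq_trans (leq_div _ _) _.
  by apply: leq_trans (leq_subr _ _) _; rewrite leq_pexp2l.
have h_inj : injective h.
  move=> r s ers; apply: val_inj; have [_ _ hr _] := hE r; have [_ _ hs _] := hE s.
  by rewrite /= -[LHS]hr ers hs.
rewrite -card_succ_dvdn -(card_image h_inj); apply: eq_card => x.
rewrite inE absz_eq0 ord_poly_eq0 //; apply/idP/imageP => /= [fx0|[r]].
  have [e0 e1 e2] : [/\ m ^ x ord0 = n * x o1 + 1, x ord0 + x o3 = P
      & x ord0 = x o2 + 1 :> nat]%N by case/and3P: fx0 => /eqP-> /eqP-> /eqP.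
  have ltr : (x o2 < P)%N by lia.
  exists (Ordinal ltr).
    by rewrite inE dvdn_mult_ord //= -addn1 -e2 e0 mulnC modnMDl.
  apply/ffunP => i; apply: val_inj; have [h0 h1 h2 h3] := hE (Ordinal ltr).
  have : i \in [:: ord0; o1; o2; o3].
    by case: i => -[|[|[|[|i]]]] lti; rewrite // !inE -!val_eqE.
  rewrite !inE => /or4P[] /eqP-> /=.
  - by rewrite h0 e2 addn1.
  - by rewrite h1 /= -[(x o2).+1]addn1 -e2 e0 addnK mulKn // ltnW.
  - by rewrite h2.
  - by rewrite h3 /= -[(x o2).+1]addn1 -e2 -[X in (X - _)%N]e1 addKn.
rewrite inE dvdn_mult_ord // => ord_r ->; have [-> -> -> ->] := hE r.
have ltrP := ltn_ord r; apply/and3P; split; apply/eqP; try lia.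
rewrite mulnC divnK ?subnK ?expn_gt0 ?m_gt0 //.
by rewrite -eqn_mod_dvd // expn_gt0 m_gt0.
Qed.

Theorem ord_cube m n P : (2 <= m)%N -> (1 < n <= m ^ P)%N -> coprime m n ->
  exists2 N : nat,
    cube_int (m ^ P + 1) (2 * m ^ (P + 1) + 2) (P%:Z ^+ 2 + 2) (ord_monos m n P) 4 = N%:Z
    & hamming N = ((2 * m ^ (P + 1) + 2) * ((m ^ P + 1) ^ 4 + P %/ mult_ord m n))%N.
Proof.
move=> m_gt1 /andP[n_gt1 le_nT] co_mn; rewrite -(card_ord_poly P m_gt1 n_gt1 co_mn) addn1.
apply: cube_count => [|x|x]; first by rewrite addn2.
  by apply: ord_poly_le => // i; rewrite -ltnS ltn_ord.
by rewrite ord_polyE gez0_abs ?ord_poly_ge0.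
Qed.

Lemma mult_ord_dvd_totient m n : coprime m n -> (mult_ord m n %| totient n)%N.
Proof. by move=> co_mn; rewrite dvdn_mult_ord //; apply/eqP/Euler_exp_totient. Qed.

Lemma leq_mult_ord m n : (0 < n)%N -> coprime m n -> (mult_ord m n <= n)%N.
Proof.
move=> n_gt0 co_mn; apply: leq_trans (dvdn_leq _ (mult_ord_dvd_totient co_mn)) _.
  by rewrite totient_gt0.
rewrite totient_count_coprime -[leqRHS]card_ord -sum1_card big_mkord.
by apply: leq_sum => i _; case: coprime.
Qed.

(** By Euler's theorem [n] divides the positive number [m ^ totient n - 1]. *)
Lemma leq_exp_totient m n : (2 <= m)%N -> (1 < n)%N -> coprime m n ->
  (n <= m ^ totient n)%N.
Proof.
move=> m_gt1 n_gt1 co_mn.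
have tot_gt0 : (0 < totient n)%N by rewrite totient_gt0; lia.
have le1 : (m ^ 1 <= m ^ totient n)%N by rewrite leq_exp2l.
have : (n %| m ^ totient n - 1)%N.
  by rewrite -eqn_mod_dvd ?(leq_trans _ le1) ?expn1 //; [apply/eqP/Euler_exp_totient | lia].
by move/dvdn_leq; rewrite expn1 in le1; lia.
Qed.

Lemma ord_M_hamming m n : (2 <= m)%N -> (1 < n)%N -> coprime m n ->
  exists2 N : nat, ord_M m n = N%:R
    & hamming N = (ord_w m n * (ord_t m n ^ 4 + totient n %/ mult_ord m n))%N.
Proof.
move=> m_gt1 n_gt1 co_mn.
have nT : (1 < n <= m ^ totient n)%N by rewrite n_gt1 leq_exp_totient.
have [N cubeN hamN] := ord_cube m_gt1 nT co_mn; exists N => //.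
rewrite ord_M_cube /ord_t addn1 cube_sum_int; last by rewrite /ord_w addn2.
by rewrite -addn1 cubeN.
Qed.

Lemma ord_expr_correct m n : (2 <= m)%N -> (1 < n)%N -> coprime m n ->
  ord_expr m n = (mult_ord m n)%:R.
Proof.
move=> m_gt1 n_gt1 co_mn; have [N MN hamN] := ord_M_hamming m_gt1 n_gt1 co_mn.
rewrite /ord_expr MN natrK hamN.
have -> : 2 * m%:R ^+ (totient n + 1) + 2 = (ord_w m n)%:R :> rat.
  by rewrite /ord_w natrD natrM natrX.
have -> : m%:R ^+ totient n + 1 = (ord_t m n)%:R :> rat by rewrite /ord_t natrD natrX.
have w0 : (ord_w m n)%:R != 0 :> rat by rewrite pnatr_eq0 /ord_w addn2.
rewrite natrM [X in X - _]mulrAC divff // mul1r natrD natrX [X in X - _]addrC addrK.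
have /dvdnP[c ec] := mult_ord_dvd_totient co_mn.
have tot_gt0 : (0 < totient n)%N by rewrite totient_gt0; lia.
rewrite [X in X%:R / _]ec [X in (X %/ _)%N]ec mulnK ?mult_ord_gt0 // natrM mulrAC divff ?mul1r //.
by rewrite pnatr_eq0 -lt0n; move: tot_gt0; rewrite ec muln_gt0 => /andP[].
Qed.

(** * The multiplicative order as an arithmetic term *)

Lemma int_representable_ord_cube k (D : ('I_k -> nat) -> Prop)
    (m n P : ('I_k -> nat) -> nat) : (forall v, D v -> (0 < m v)%N) ->
    representable D m -> representable D n -> representable D P ->
  int_representable D (fun v =>
    cube_int (m v ^ P v + 1) (2 * m v ^ (P v + 1) + 2) ((P v)%:Z ^+ 2 + 2)
      (ord_monos (m v) (n v) (P v)) 4).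
Proof.
move=> m_gt0 repm repn repP; have repc c : representable D (fun=> c).
  exact: representable_cst.
pose t v := (m v ^ P v + 1)%N; pose w v := (2 * m v ^ (P v + 1) + 2)%N.
have rept : representable D t.
  by apply: representable_add => //; apply: representable_exp.
have repw : representable D w.
  apply: representable_add => //; apply: representable_mul => //.
  by apply: representable_exp => //; apply: representable_add.
have tw_gt0 v : D v -> (0 < t v)%N /\ (0 < w v)%N by rewrite /t /w addn1 addn2.
have zrep1 : int_representable D (fun=> 1) by exact: int_representable_nat (repc 1%N).
have zrep2 : int_representable D (fun=> 2) by exact: int_representable_nat (repc 2%N).
have zrepn := int_representable_nat repn; have zrepP := int_representable_nat repP.
have zrep_exp2w : int_representable D (fun v => 2 ^+ w v).
  apply: (@int_representable_ext _ _ (fun v => (2 ^ w v)%N%:Z)) => [v _|].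
    by rewrite PoszX.
  by apply: int_representable_nat; apply: representable_exp.
have zrep_sqr z : int_representable D z -> int_representable D (fun v => z v ^+ 2).
  by move=> repz; apply: int_representable_mul.
have rep_mono c pe : int_representable D c ->
  int_representable D (fun v => mono_gsum 4 (t v) (w v) (Mono (c v) [::] [::] pe)).
  move=> repz; apply: int_representable_mono_gsum => //.
  by move=> v i _; rewrite !nth_nil.
have rep_exp_mono c b pe : int_representable D c ->
  int_representable D (fun v => mono_gsum 4 (t v) (w v) (Mono (c v) [:: m v] [:: b] pe)).
  move=> repz; apply: int_representable_mono_gsum => // [v [|i] Dv /=|[|i]].
  - by rewrite expn_gt0 m_gt0.
  - by rewrite !nth_nil.
  - exact: representable_exp.
  - by apply: representable_ext (repc 1%N) => v _; rewrite /= !nth_nil.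
apply: int_representable_mul.
  by apply: int_representable_add => //; apply: int_representable_opp.
apply: int_representable_add.
  apply: int_representable_mul; last exact: rep_mono.
  apply: int_representable_add => //; apply: int_representable_add => //.
  apply: int_representable_opp; apply: int_representable_add => //.
  exact: zrep_sqr.
apply: int_representable_opp; rewrite /ord_monos.
do !apply: int_representable_big_cons.
all: try exact: int_representable_big_nil.
all: first [apply: rep_mono | apply: rep_exp_mono].
all: repeat first [assumption | apply: zrep_sqr | apply: int_representable_opp
  | apply: int_representable_mul | apply: int_representable_add].
Qed.

(** Any [P] with [n <= m ^ P] makes the Hamming weight count the multiples of the order up
    to [P].  The choice [P = n ^ 2] needs no term for the totient, and it is large enough for
    the order to be recovered from the rounded quotient. *)
Lemma representable_mult_ord k (D : ('I_k -> nat) -> Prop) (m n : ('I_k -> nat) -> nat) :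
    (forall v, D v -> [/\ (2 <= m v)%N, (1 < n v)%N & coprime (m v) (n v)]) ->
    representable D m -> representable D n ->
  representable D (fun v => mult_ord (m v) (n v)).
Proof.
move=> dom repm repn; pose P v := (n v ^ 2)%N.
pose t v := (m v ^ P v + 1)%N; pose w v := (2 * m v ^ (P v + 1) + 2)%N.
pose Z v := cube_int (t v) (w v) ((P v)%:Z ^+ 2 + 2) (ord_monos (m v) (n v) (P v)) 4.
have ZE v : D v -> Z v = `|Z v|%N%:Z /\
    hamming `|Z v| = (w v * (t v ^ 4 + P v %/ mult_ord (m v) (n v)))%N.
  move=> /dom[m_gt1 n_gt1 co_mn]; have nT : (1 < n v <= m v ^ P v)%N.
    have le_nP : (n v <= P v)%N by rewrite /P -mulnn leq_pmulr // ltnW.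
    by rewrite n_gt1 (leq_trans le_nP) //; apply/ltnW/ltn_expl.
  by have [N ZN hamN] := ord_cube m_gt1 nT co_mn; rewrite /Z ZN.
have repc c : representable D (fun=> c) by apply: representable_cst.
have repP : representable D P by apply: representable_exp.
have repN : representable D (fun v => `|Z v|%N).
  apply: int_representableP; apply: (int_representable_ext (fun v Dv => (ZE v Dv).1)).
  by apply: int_representable_ord_cube => // v /dom[/ltnW].
have rept : representable D t.
  by apply: representable_add => //; apply: representable_exp.
have repw : representable D w.
  apply: representable_add => //; apply: representable_mul => //.
  by apply: representable_exp => //; apply: representable_add.
apply: (@representable_ext _ _ (fun v => P v %/ (hamming `|Z v| %/ w v - t v ^ 4))%N).
  move=> v Dv; have [m_gt1 n_gt1 co_mn] := dom v Dv; have [_ ->] := ZE v Dv.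
  rewrite mulKn ?addKn; last by rewrite /w addn2.
  apply: divn_divn_small; rewrite leq_divRL ?mult_ord_gt0 // /P -mulnn.
  by apply: leq_mul; apply: leq_mult_ord => //; apply: ltnW.
apply: representable_div => //; apply: representable_sub; last exact: representable_exp.
by apply: representable_div => //; apply: representable_hamming.
Qed.

Theorem theorem10p6 :
  exists e : aterm 2,
    forall m n : nat,
      (3 <= n)%N -> (2 <= m <= n - 1)%N -> coprime m n ->
      [/\ ord_M m n \is a Num.nat,
          ord_expr m n = (mult_ord m n)%:R
        & (aeval (tnth [tuple m; n]) e)%:R = ord_expr m n].
Proof.
have [e eE] : representable
    (fun v : 'I_2 -> nat =>
       [/\ (2 <= v ord0)%N, (1 < v ord_max)%N & coprime (v ord0) (v ord_max)])
    (fun v => mult_ord (v ord0) (v ord_max)).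
  by apply: representable_mult_ord => //; apply: representable_var.
exists e => m n n_gt2 /andP[m_gt1 _] co_mn; have n_gt1 := ltnW n_gt2.
have [N MN _] := ord_M_hamming m_gt1 n_gt1 co_mn.
split; first by rewrite MN natr_nat.
  exact: ord_expr_correct.
by rewrite ord_expr_correct // eE.
Qed.
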